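(* Let $G$ be a finite bipartite graph and let $r$ be a positive integer with $r\le\lfloor \frac{e(G)}{2}\rfloor$. Then $G$ is bipartite $r$-tonal if and only if there is a set of vertices $U\subseteq V(G)$ such that $e_G(U,N_G(U))=r$ and $U$ is contained in one of the partition sets of $G$.
   Context: $e(G)$ is the number of edges of $G$, $N_G(U)$ is the set of vertices adjacent to some vertex of $U$, and $e_G(X,Y)$ is the number of edges of $G$ with one endpoint in $X$ and the other in $Y$. ''$U$ is contained in one of the partition sets of $G$'' means that there is a bipartition $V(G)=X_G\sqcup Y_G$ of $G$ (both parts independent) with $U\subseteq X_G$. A $2$-edge coloring of $K_{n,n}$ is a partition $E(K_{n,n})=R\sqcup B$ into red edges $R$ and blue edges $B$. An $(a,b)$-colored copy of $G$ is a (not necessarily induced) subgraph of $K_{n,n}$ isomorphic to $G$ with exactly $a$ red edges and exactly $b$ blue edges. For an integer $0\le r\le\lfloor e(G)/2\rfloor$, let $\mathrm{bbal}_r(n,G)$ be the minimum nonnegative integer $k<\lfloor n^2/2\rfloor$, if it exists, such that every $2$-edge coloring $E(K_{n,n})=R\sqcup B$ with $\min\{|R|,|B|\}>k$ contains an $(r,e(G)-r)$-colored copy of $G$ or an $(e(G)-r,r)$-colored copy of $G$. (The requirement $k<\lfloor n^2/2\rfloor$ ensures that colorings with $\min\{|R|,|B|\}>k$ exist.) The graph $G$ is bipartite $r$-tonal if $\mathrm{bbal}_r(n,G)$ exists for every sufficiently large $n$. *)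

(* Defs.v *)
From mathcomp Require Import all_boot.

Set Implicit Arguments.
Unset Strict Implicit.
Unset Printing Implicit Defensive.

Record sgraph := SGraph {
  vertex :> finType;
  adj : rel vertex;
  adj_sym : symmetric adj;
  adj_irrefl : irreflexive adj
}.

Section Graphs.
Variable G : sgraph.

(* Edges are unordered pairs of adjacent vertices. *)
Definition edges : {set {set G}} :=
  [set [set p.1; p.2] | p in [pred p : G * G | adj p.1 p.2]].

Definition nedges : nat := #|edges|.

Definition neighbors (U : {set G}) : {set G} :=
  [set v | [exists u in U, adj u v]].

(* An edge with both endpoints in X :&: Y is counted once. *)
Definition edges_between (X Y : {set G}) : nat :=
  #|[set E in edges | [exists x in X, exists y in Y, E == [set x; y]]]|.

Definition independent (X : {set G}) : Prop := {in X &, forall x y, ~~ adj x y}.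

Definition bipartition (X Y : {set G}) : Prop :=
  [/\ X :|: Y = setT, X :&: Y = set0, independent X & independent Y].

Definition bipartite : Prop := exists X Y : {set G}, bipartition X Y.

Definition in_partition_set (U : {set G}) : Prop :=
  exists X Y : {set G}, bipartition X Y /\ U \subset X.

End Graphs.

Definition Knn_adj (n : nat) (x y : 'I_n + 'I_n) : bool :=
  match x, y with
  | inl _, inr _ | inr _, inl _ => true
  | _, _ => false
  end.

Lemma Knn_adj_sym n : symmetric (@Knn_adj n).
Proof. by case=> ? []. Qed.

Lemma Knn_adj_irrefl n : irreflexive (@Knn_adj n).
Proof. by case. Qed.

Definition Knn (n : nat) : sgraph :=
  SGraph (@Knn_adj_sym n) (@Knn_adj_irrefl n).

(* The subgraph of H with vertex set W and edge set F is isomorphic to G. *)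
Definition is_copy (G H : sgraph) (W : {set H}) (F : {set {set H}}) : Prop :=
  F \subset edges H /\
  exists f : G -> H,
    [/\ injective f, f @: [set: G] = W & F = [set f @: E | E : {set G} in edges G]].
Arguments is_copy : clear implicits.

Definition coloring (n : nat) (R B : {set {set Knn n}}) : Prop :=
  R :|: B = edges (Knn n) /\ R :&: B = set0.

Definition has_colored_copy (G : sgraph) (n : nat) (R B : {set {set Knn n}})
    (a b : nat) : Prop :=
  exists (W : {set Knn n}) (F : {set {set Knn n}}),
    [/\ is_copy G (Knn n) W F, #|F :&: R| = a & #|F :&: B| = b].

Definition bbal_bound (r n : nat) (G : sgraph) (k : nat) : Prop :=
  k < (n ^ 2) %/ 2 /\
  forall R B : {set {set Knn n}}, coloring R B -> k < minn #|R| #|B| ->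
    has_colored_copy G R B r (nedges G - r) \/
    has_colored_copy G R B (nedges G - r) r.

(* bbal_r(n, G) exists and equals k; meant for r <= nedges G %/ 2. *)
Definition is_bbal (r n : nat) (G : sgraph) (k : nat) : Prop :=
  bbal_bound r n G k /\ forall k', bbal_bound r n G k' -> k <= k'.

Definition bipartite_tonal (r : nat) (G : sgraph) : Prop :=
  exists N : nat, forall n : nat, N <= n -> exists k : nat, is_bbal r n G k.

(* Main.v *)
Require Import Defs.
From mathcomp Require Import all_boot.
From mathcomp Require Import zify.
From Stdlib Require Import Classical.

(** Only balanced colorings matter: [bbal_r(n, G)] exists as soon as
    [k = n^2/2 - 1] is admissible.  If tonality holds, color red the edges of
    [K_{2m,2m}] meeting a fixed half [A] of the left side; the preimage of [A]
    (or of the other half) in a suitably colored copy of [G] is the required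
    [U].  Conversely, in a balanced coloring of a large [K_{n,n}], many vertices
    on one side have linear degree in both colors: otherwise more than [n/4]
    left vertices are almost completely red and more than [n/4] right vertices
    are almost completely blue, which is contradictory.  Pigeonhole among those
    vertices gives large [T], [C1], [C2] such that [T * C1] is red
    and [T * C2] is blue; mapping [U] into [C1], the rest of its side into [C2],
    and the other side into [T] gives a copy with exactly [r] red edges. *)

Set Implicit Arguments.
Unset Strict Implicit.
Unset Printing Implicit Defensive.

(** * Degree counting and split stars in balanced relations *)

Definition deg (A B : finType) (e : A -> B -> bool) (x : A) : nat :=
  #|[set y | e x y]|.

(** With [e] read as red, this is the pattern unavoidable in balanced colorings. One set [T] serves
    both colors, so it can host a whole side of [G]. *)
Definition split_star (A B : finType) (e : A -> B -> bool) (t : nat) : Prop :=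
  exists (T : {set A}) (C1 C2 : {set B}),
    [/\ t <= #|T|, t <= #|C1|, t <= #|C2|,
        forall x y, x \in T -> y \in C1 -> e x y
      & forall x y, x \in T -> y \in C2 -> ~~ e x y].

Lemma degE (A B : finType) (e : A -> B -> bool) (x : A) :
  deg e x = \sum_y e x y.
Proof.
rewrite /deg -sum1dep_card big_mkcond.
by apply: eq_bigr => y _; case: (e x y).
Qed.

Lemma sum_deg_sym (A B : finType) (e : A -> B -> bool) :
  \sum_x deg e x = \sum_y deg (fun y x => e x y) y.
Proof.
under eq_bigr do rewrite degE; rewrite exchange_big /=.
by apply: eq_bigr => y _; rewrite degE.
Qed.

Lemma sum_deg (A B : finType) (e : A -> B -> bool) :
  \sum_x deg e x = #|[set p : A * B | e p.1 p.2]|.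
Proof.
rewrite -sum1_card (eq_bigl (fun p : A * B => e p.1 p.2)); last first.
  by move=> p; rewrite inE.
rewrite -(pair_big_dep xpredT (fun x y => e x y) (fun _ _ => 1)) /=.
by apply: eq_bigr => x _; rewrite sum1dep_card.
Qed.

Lemma sum_deg_in (A B : finType) (e : A -> B -> bool) (S : {set A}) :
  \sum_(x in S) deg e x = \sum_y #|[set x in S | e x y]|.
Proof.
transitivity (\sum_(x in S) \sum_(y | e x y) 1).
  by apply: eq_bigr => x _; rewrite sum1dep_card.
rewrite (exchange_big_dep xpredT) //=; apply: eq_bigr => y _.
by rewrite sum1dep_card.
Qed.

(** Group the elements of [B] by their neighborhood in [S]. If every neighborhood with at least
    |S|/16 elements had fewer than [t] members in its class, these classes would contribute at most
    2^|S| t |S| < |S||B|/16 to the degree sum over [S], and the remaining ones at most |S||B|/16,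
    short of the |S||B|/8 that the degree hypothesis forces. *)
Lemma biclique (A B : finType) (e : A -> B -> bool) (S : {set A}) (t : nat) :
  0 < #|S| -> (forall x, x \in S -> #|B| <= 8 * deg e x) ->
  16 * t * 2 ^ #|S| < #|B| ->
  exists (T : {set A}) (C : {set B}),
    [/\ T \subset S, #|S| <= 16 * #|T|, t <= #|C|
      & forall x y, x \in T -> y \in C -> e x y].
Proof.
move=> S0 degS ltB; pose N y := [set x in S | e x y].
pose fib P := [set y | N y == P].
have [/existsP [T /and3P [TS bigT bigC]]|] := boolP [exists T : {set A},
    [&& T \subset S, #|S| <= 16 * #|T| & t <= #|fib T|]].
  exists T, (fib T); split=> // x y xT; rewrite inE => /eqP yT.
  by move: xT; rewrite -yT inE => /andP [].
move=> /existsPn nex.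
have NS y : N y \in powerset S by rewrite inE; apply/subsetP=> x; rewrite inE => /andP[].
have fibE : \sum_(P in powerset S) #|fib P| = #|B|.
  rewrite -sum1_card (partition_big N (mem (powerset S))) //=.
  by apply: eq_bigr => P _; rewrite -sum1_card; apply: eq_bigl => y; rewrite !inE.
have sumE : \sum_(x in S) deg e x = \sum_(P in powerset S) #|fib P| * #|P|.
  rewrite sum_deg_in (partition_big N (mem (powerset S))) //=.
  apply: eq_bigr => P _; rewrite -sum_nat_const.
  by apply: eq_big => [y|y /eqP <-]; rewrite ?inE.
have low : #|S| * #|B| <= 8 * \sum_(x in S) deg e x.
  by rewrite -sum_nat_const big_distrr; apply: leq_sum => x /degS.
have up : 16 * \sum_(P in powerset S) #|fib P| * #|P| <=
    2 ^ #|S| * (16 * t * #|S|) + #|S| * #|B|.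
  rewrite -fibE -card_powerset -sum_nat_const !big_distrr -big_split /=.
  apply: leq_sum => P; rewrite inE => PS.
  have := nex P; rewrite PS /=; have := subset_leq_card PS.
  case: (leqP #|S| (16 * #|P|)) => /= [_ PleS|]; last by nia.
  by rewrite -ltnNge => ?; nia.
by rewrite -sumE in up; nia.
Qed.

(** [biclique] is applied for red, then for blue inside the set it returned. Each round keeps a
    sixteenth of the centers, whence 256 = 16 * 16. First trimming [S] to exactly 256 t elements
    keeps the exponential bound independent of [S]. *)
Lemma split_star_of_balanced (A B : finType) (e : A -> B -> bool) (S : {set A})
    (t : nat) :
  0 < t -> 256 * t <= #|S| ->
  (forall x, x \in S ->
     #|B| <= 8 * deg e x /\ #|B| <= 8 * deg (fun x y => ~~ e x y) x) ->
  16 * t * 2 ^ (256 * t) < #|B| -> split_star e t.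
Proof.
move=> t0 bigS balS ltB.
have [S' S'S cardS'] : exists2 S' : {set A}, S' \subset S & #|S'| = 256 * t.
  have : 0 < #|[set X : {set A} | X \subset S & #|X| == 256 * t]|.
    by rewrite cards_draws bin_gt0.
  by case/card_gt0P=> X; rewrite inE => /andP[XS /eqP]; exists X.
have [|||T1 [C1 [T1S' bigT1 bigC1 red]]] := @biclique A B e S' t.
- by rewrite cardS'; lia.
- by move=> x /(subsetP S'S) /balS [].
- by rewrite cardS'.
have T1le := subset_leq_card T1S'.
have [|||T2 [C2 [T2T1 bigT2 bigC2 blue]]] :=
    @biclique A B (fun x y => ~~ e x y) T1 t.
- by lia.
- by move=> x /(subsetP T1S') /(subsetP S'S) /balS [].
- apply: leq_ltn_trans ltB; rewrite leq_mul2l leq_exp2l // -cardS' T1le.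
  by rewrite orbT.
exists T2, C1, C2; split=> //; first by lia.
by move=> x y /(subsetP T2T1); apply: red.
Qed.

(** A vertex outside both [S] and [P] has red degree below n/8, so 8 times the number of red edges
    is at most 8n|P| + 8n|S| + n^2. Balance makes it at least 4n^2 - 4, and [S] is too small to fill
    the gap. The [+ 1] in the balance hypothesis absorbs the rounding of n^2/2 for odd [n]. *)
Lemma many_nearly_full (A B : finType) (e : A -> B -> bool) (n m : nat) :
  #|A| = n -> #|B| = n -> 8 * m + 8 < n ->
  #|[set x | (n <= 8 * deg e x) && (n <= 8 * deg (fun x y => ~~ e x y) x)]| < m ->
  n ^ 2 <= 2 * #|[set p : A * B | e p.1 p.2]| + 1 ->
  n < 4 * #|[set x | 8 * deg (fun x y => ~~ e x y) x < n]|.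
Proof.
move=> cA cB ltn; set S := [set x | _ && _]; set P := [set x | _ < _] => ltS.
rewrite -sum_deg => bal.
have : 8 * \sum_x deg e x <= #|P| * (8 * n) + #|S| * (8 * n) + #|A| * n.
  rewrite -!sum_nat_const big_distrr /= [X in X + _ + _]big_mkcond.
  rewrite [X in _ + X + _]big_mkcond -!big_split; apply: leq_sum => x _ /=.
  have := max_card [set y | e x y]; rewrite cB -/(deg e x) !inE.
  by case: ifP => ?; case: ifP => ? ?; lia.
by rewrite cA => ?; nia.
Qed.

Lemma unavoidable_split_star (n t : nat) (e : 'I_n -> 'I_n -> bool) :
  0 < t -> 16 * t * 2 ^ (256 * t) < n ->
  n ^ 2 <= 2 * #|[set p : 'I_n * 'I_n | e p.1 p.2]| + 1 ->
  n ^ 2 <= 2 * #|[set p : 'I_n * 'I_n | ~~ e p.1 p.2]| + 1 ->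
  split_star e t \/ split_star (fun y x => e x y) t.
Proof.
move=> t0 ltn balR balB; pose e' := fun y x => e x y.
have ltn8 : 8 * (256 * t) + 8 < n.
  have := ltn_expl (256 * t) (isT : 1 < 2); nia.
pose S (f : 'I_n -> 'I_n -> bool) := [set x |
  (n <= 8 * deg f x) && (n <= 8 * deg (fun x y => ~~ f x y) x)].
have starS f : 256 * t <= #|S f| -> split_star f t.
  move=> bigS; apply: (@split_star_of_balanced _ _ f (S f)) => //.
    by move=> x; rewrite inE card_ord => /andP.
  by rewrite card_ord.
have [/starS|ltS] := leqP (256 * t) #|S e|; first by left.
have [/starS|ltS'] := leqP (256 * t) #|S e'|; first by right.
exfalso.
have := many_nearly_full (card_ord n) (card_ord n) ltn8 ltS balR.
set P := [set x | _]; move=> bigP.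
(* Having linear degree in both colors is symmetric in the colors, so the bound for [e'] carries
   over to its complement; this yields right vertices that are almost entirely blue. *)
have ltS'' : #|S (fun y x => ~~ e' y x)| < 256 * t.
  apply: leq_ltn_trans ltS'; apply: subset_leq_card; apply/subsetP => y.
  rewrite !inE andbC; congr (is_true (_ && _)).
  by congr (_ <= 8 * _); apply: eq_card => x; rewrite !inE negbK.
have balB' : n ^ 2 <= 2 * #|[set p : 'I_n * 'I_n | ~~ e' p.1 p.2]| + 1.
  rewrite -(sum_deg (fun x y => ~~ e x y)) in balB.
  by rewrite sum_deg_sym in balB; rewrite -(sum_deg (fun y x => ~~ e' y x)).
have := many_nearly_full (card_ord n) (card_ord n) ltn8 ltS'' balB'.
set Q := [set x | _]; move=> bigQ.
(* A pair in P x Q is either blue, and counted at its end in [P], or red, and counted at its end in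
   [Q]. Both counts run below n/8 per vertex, so |P||Q| <= (|P| + |Q|) n/8, impossible when both
   sets exceed n/4. *)
have cross : #|P| * #|Q| <= \sum_(x in P) deg (fun x y => ~~ e x y) x +
    \sum_(y in Q) deg e' y.
  have -> : \sum_(x in P) deg (fun x y => ~~ e x y) x =
      \sum_(x in P) \sum_y ~~ e x y.
    by apply: eq_bigr => x _; rewrite degE.
  have -> : \sum_(y in Q) deg e' y = \sum_x \sum_(y in Q) e x y.
    by rewrite exchange_big; apply: eq_bigr => y _; rewrite degE.
  rewrite -sum_nat_const.
  apply: (@leq_trans (\sum_(x in P) (\sum_y ~~ e x y + \sum_(y in Q) e x y))).
    apply: leq_sum => x _; rewrite -sum1_card [X in X + _](bigID (mem Q)) /=.
    rewrite addnAC -big_split /=; apply: leq_trans (leq_addr _ _).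
    by apply: leq_sum => y _; case: (e x y).
  rewrite big_split leq_add2l [leqRHS](bigID (mem P)) /=; exact: leq_addr.
have upP : 8 * \sum_(x in P) deg (fun x y => ~~ e x y) x <= #|P| * n.
  rewrite -sum_nat_const big_distrr; apply: leq_sum => x.
  by rewrite inE => /ltnW.
have upQ : 8 * \sum_(y in Q) deg e' y <= #|Q| * n.
  rewrite -sum_nat_const big_distrr; apply: leq_sum => y.
  rewrite inE => /ltnW; apply: leq_trans; rewrite leq_mul2l /=.
  by apply: subset_leq_card; apply/subsetP => x; rewrite !inE negbK.
by nia.
Qed.

(** * Edges meeting a vertex set, and embedding [G] into a split star *)

Lemma edgesP (G : sgraph) (E : {set G}) :
  reflect (exists x y, adj x y /\ E = [set x; y]) (E \in edges G).
Proof.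
apply: (iffP imsetP) => [[[x y]]|[x [y [xy ->]]]].
  by rewrite inE /= => xy ->; exists x, y.
by exists (x, y); rewrite ?inE.
Qed.

Definition incident_edges (G : sgraph) (U : {set G}) : {set {set G}} :=
  [set E in edges G | ~~ [disjoint E & U]].

(** The other end of an edge that meets [U] lies in [neighbors U] automatically. *)
Lemma edges_between_neighbors (G : sgraph) (U : {set G}) :
  edges_between U (neighbors U) = #|incident_edges U|.
Proof.
apply: eq_card => E; rewrite !inE; apply: andb_id2l => /edgesP[x [y [xy ->]]].
have tr (a b : G) : adj a b -> a \in U -> [exists x0 in U, exists y0 in neighbors U,
    [set a; b] == [set x0; y0]].
  move=> ab aU; apply/existsP; exists a; rewrite aU; apply/existsP; exists b.
  by rewrite eqxx andbT inE; apply/existsP; exists a; rewrite aU.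
apply/idP/idP.
  case/existsP=> a /andP[aU /existsP[b /andP[_ /eqP->]]].
  by apply/pred0Pn; exists a; rewrite /= aU !inE eqxx.
case/pred0Pn=> a /andP[] /=; rewrite !inE => /orP[] /eqP -> aU; first exact: tr.
by rewrite setUC; apply: tr => //; rewrite adj_sym.
Qed.

Lemma inject_into (G V : finType) (C : {set V}) :
  #|G| <= #|C| -> exists2 g : G -> V, injective g & forall x, g x \in C.
Proof.
move=> le; exists (fun x => enum_val (widen_ord le (enum_rank x))).
  move=> x y /enum_val_inj /(congr1 val) /= eq_rank.
  by apply: enum_rank_inj; apply: val_inj.
by move=> x; apply: enum_valP.
Qed.

Lemma imset_pair (S T : finType) (f : S -> T) x y :
  f @: [set x; y] = [set f x; f y].
Proof. by rewrite imsetU !imset_set1. Qed.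

Lemma colored_copy_of_split_star (G : sgraph) (n : nat) (R B : {set {set Knn n}})
    (U : {set G}) (T C1 C2 : {set Knn n}) :
  coloring R B -> in_partition_set U -> 0 < #|G| ->
  #|G| <= #|T| -> #|G| <= #|C1| -> #|G| <= #|C2| ->
  (forall x y, x \in T -> y \in C1 -> [set x; y] \in R) ->
  (forall x y, x \in T -> y \in C2 -> [set x; y] \in B) ->
  has_colored_copy G R B #|incident_edges U| (nedges G - #|incident_edges U|).
Proof.
case=> RB RB0 [X [Y [[XY XY0 indX indY] UX]]] G0 cT cC1 cC2 red blue.
have disRB E : E \in R -> E \in B -> False.
  by move=> ER EB; have := in_set0 E; rewrite -RB0 inE ER EB.
have [gT injT gTT] := inject_into cT.
have [g1 inj1 g1C] := inject_into cC1.
have [g2 inj2 g2C] := inject_into cC2.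
have [x0 _] : exists x, x \in G by apply/card_gt0P.
have edge_neq x y : [set x; y] \in edges (Knn n) -> x != y.
  apply: contraTneq => ->; apply/edgesP => -[a [b [ab /setP E]]].
  have := E a; have := E b; rewrite !inE !eqxx orbT orbb => /eqP bE.
  by rewrite orbb => /eqP aE; move: ab; rewrite aE bE adj_irrefl.
(* The three target sets are disjoint because of the colors: a common vertex of [T] and some [Ci]
   would make a singleton an edge, and a common vertex of [C1] and [C2] would give a doubly colored
   edge to [T]. *)
have T1 x y : x \in T -> y \in C1 -> x != y.
  by move=> xT yC; apply: edge_neq; rewrite -RB inE red.
have T2 x y : x \in T -> y \in C2 -> x != y.
  by move=> xT yC; apply: edge_neq; rewrite -RB inE blue ?orbT.
have C12 x y : x \in C1 -> y \in C2 -> x != y.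
  move=> xC yC; apply/eqP => xy; rewrite -xy in yC.
  by apply: (disRB [set gT x0; x]); [apply: red | apply: blue].
pose f x := if x \in U then g1 x else if x \in X then g2 x else gT x.
have finj : injective f.
  move=> x y; rewrite /f.
  have nf a b : a != b -> a = b :> Knn n -> x = y by move/eqP.
  case: ifP => _; last case: ifP => _; (case: ifP => _; last case: ifP => _).
  - exact: inj1.
  - by apply: nf; apply: C12.
  - by apply: nf; rewrite eq_sym; apply: T1.
  - by apply: nf; rewrite eq_sym; apply: C12.
  - exact: inj2.
  - by apply: nf; rewrite eq_sym; apply: T2.
  - by apply: nf; apply: T1.
  - by apply: nf; apply: T2.
  - exact: injT.
have side x y : adj x y -> (x \in X) != (y \in X).
  move=> xy; apply/negP => /eqP eqX.
  have [xX|xX] := boolP (x \in X).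
    by have := indX x y; rewrite xy -eqX; move=> /(_ xX xX).
  have inY z : z \notin X -> z \in Y.
    by move=> zX; have := in_setT z; rewrite -XY inE (negPf zX).
  by have := indY x y (inY _ xX) (inY _ _); rewrite xy -eqX; move=> /(_ xX).
(* Each edge has exactly one end in [X], and its other end avoids [U] and goes to [T]. So the color
   depends only on whether the end in [X] lies in [U]. *)
have colE E : E \in edges G -> if ~~ [disjoint E & U] then f @: E \in R
    else f @: E \in B.
  suff main a b : adj a b -> a \in X -> b \notin X ->
      if ~~ [disjoint [set a; b] & U] then f @: [set a; b] \in R
      else f @: [set a; b] \in B.
    case/edgesP=> a [b [ab ->]]; have := side _ _ ab.
    have [aX|aX] := boolP (a \in X); have [bX|bX] := boolP (b \in X) => // _.
      exact: main.
    by rewrite setUC; apply: main; rewrite // adj_sym.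
  move=> ab aX bX; have bU : b \notin U by apply: contra bX; apply/subsetP.
  have -> : ~~ [disjoint [set a; b] & U] = (a \in U).
    apply/pred0Pn/idP => [[c /andP[]]|aU]; last first.
      by exists a; rewrite /= aU !inE eqxx.
    by rewrite /= !inE => /orP[]/eqP-> //; rewrite (negPf bU).
  rewrite imset_pair setUC.
  rewrite /f (negPf bU) (negPf bX) aX.
  by case: ifP => aU; rewrite ?aU; [apply: red | apply: blue].
pose F := [set f @: E | E : {set G} in edges G].
have FR : F :&: R = [set f @: E | E : {set G} in incident_edges U].
  apply/setP => D; rewrite inE; apply/andP/imsetP.
    case=> /imsetP[E EG ->] ER; exists E => //; rewrite inE EG /=.
    by have := colE E EG; case: ifP => // _ /(disRB _ ER).
  case=> E; rewrite inE => /andP[EG EU] ->; split; first exact: imset_f.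
  by have := colE E EG; rewrite EU.
have FRB : F \subset R :|: B.
  apply/subsetP => D /imsetP[E /colE col ->]; rewrite inE.
  by move: col; case: ifP => _ ->; rewrite ?orbT.
have cardFR : #|F :&: R| = #|incident_edges U|.
  by rewrite FR card_imset //; apply: imset_inj.
exists (f @: setT), F; split=> //.
  by split; [rewrite -RB | exists f].
have -> : F :&: B = F :\: R.
  apply/setP => D; rewrite !inE andbC; apply: andb_id2r => DF.
  have := subsetP FRB D DF; rewrite inE => /orP[DR|DB].
    by rewrite DR; apply/negP => /(disRB _ DR).
  by rewrite DB; apply/esym/negP => /disRB; apply.
by rewrite cardsD cardFR card_imset //; apply: imset_inj.
Qed.

(** * Edges of [Knn n] as pairs of a left and a right index *)

Definition pair_edges (n : nat) (P : {set 'I_n * 'I_n}) : {set {set Knn n}} :=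
  [set ([set inl p.1; inr p.2] : {set Knn n}) | p in P].

Lemma pair_edge_inj (n : nat) :
  injective (fun p : 'I_n * 'I_n => [set inl p.1; inr p.2] : {set Knn n}).
Proof.
move=> [a b] [c d] /= /setP E.
have := E (inl a); have := E (inr b); rewrite !inE !eqxx orbT /=.
by move=> /esym /eqP [->] /esym; rewrite orbF => /eqP [->].
Qed.

Lemma card_pair_edges (n : nat) (P : {set 'I_n * 'I_n}) : #|pair_edges P| = #|P|.
Proof. exact/card_imset/pair_edge_inj. Qed.

Lemma edges_Knn (n : nat) : edges (Knn n) = pair_edges [set: 'I_n * 'I_n].
Proof.
apply/setP => E; apply/edgesP/imsetP => [[x [y [xy ->]]]|[p _ ->]].
  case: x y xy => [i|i] [j|j] //= _; first by exists (i, j); rewrite ?inE.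
  by exists (j, i); rewrite ?inE // setUC.
by exists (inl p.1), (inr p.2).
Qed.

Lemma card_coloring (n : nat) (R B : {set {set Knn n}})
    (e := fun i j : 'I_n => [set inl i; inr j] \in R) :
  coloring R B ->
  #|R| = #|[set p : 'I_n * 'I_n | e p.1 p.2]| /\
  #|B| = #|[set p : 'I_n * 'I_n | ~~ e p.1 p.2]|.
Proof.
case=> RB RB0; rewrite -!card_pair_edges; split; apply: eq_card => E.
  apply/idP/imsetP => [ER|[p pe ->]]; last by rewrite inE in pe.
  have : E \in edges (Knn n) by rewrite -RB inE ER.
  by rewrite edges_Knn => /imsetP[p _ Ep]; exists p; rewrite // inE /e -Ep.
apply/idP/imsetP => [EB|[p pe ->]].
  have : E \in edges (Knn n) by rewrite -RB inE EB orbT.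
  rewrite edges_Knn => /imsetP[p _ Ep]; exists p; rewrite // inE /e -Ep.
  by apply/negP => ER; have := in_set0 E; rewrite -RB0 inE ER EB.
have : [set inl p.1; inr p.2] \in edges (Knn n).
  by rewrite edges_Knn; apply: imset_f.
by rewrite -RB inE => /orP[pR|//]; move: pe; rewrite inE /e pR.
Qed.

(** An edge of the copy has its left end in [A] exactly when the corresponding edge of [G] meets the
    preimage of [A]. The two sides of [Knn n] pull back to a bipartition of [G], and this preimage
    lies in its left part. *)
Lemma incident_edges_of_copy (G : sgraph) (n : nat) (A : {set 'I_n})
    (W : {set Knn n}) (F : {set {set Knn n}}) :
  is_copy G (Knn n) W F ->
  exists U : {set G},
    #|incident_edges U| = #|F :&: pair_edges (setX A setT)| /\ in_partition_set U.
Proof.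
case=> FK [f [finj _ FE]].
have adjf x y : adj x y -> adj (f x) (f y).
  move=> xy; have : f @: [set x; y] \in edges (Knn n).
    apply: (subsetP FK); rewrite FE; apply: imset_f; apply/edgesP.
    by exists x, y.
  rewrite imset_pair => /edgesP[a [b [ab /setP E]]].
  have := E a; have := E b; rewrite !inE !eqxx orbT /=.
  move=> /orP[]/eqP bE /orP[]/eqP aE; rewrite aE bE in ab => //.
  - by rewrite adj_irrefl in ab.
  - by rewrite Knn_adj_sym.
  - by rewrite adj_irrefl in ab.
(* The argument [A] stays free: [left A] is the witness, while [left setT] is the partition set
   containing it. *)
pose left (A : {set 'I_n}) := [set x | if f x is inl i then i \in A else false].
exists (left A); split.
  rewrite -(card_imset _ (imset_inj finj)); apply: eq_card => D.
  rewrite inE FE; apply/imsetP/andP.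
    case=> E; rewrite inE => /andP[EG EU] ->; split; first exact: imset_f.
    suff main a b : adj a b -> a \in left A ->
        f @: [set a; b] \in pair_edges (setX A setT).
      case/edgesP: EG EU => a [b [ab ->]] /pred0Pn[c /andP[]] /=.
      rewrite !inE => /orP[]/eqP-> cA; first by apply: main; rewrite // inE.
      by rewrite setUC; apply: main; rewrite ?inE // adj_sym.
    rewrite inE imset_pair => /adjf.
    case: (f a) (f b) => [i|i] [j|j] //= _ iA.
    by apply/imsetP; exists (i, j); rewrite // !inE iA.
  case=> /imsetP[E EG ->] /imsetP[[i j]]; rewrite !inE andbT /= => iA Eij.
  exists E; rewrite // inE EG; apply/pred0Pn.
  have : inl i \in f @: E by rewrite Eij !inE eqxx.
  by case/imsetP=> x xE fx; exists x; rewrite /= xE inE -fx.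
exists (left setT), (~: left setT); split; last first.
  by apply/subsetP => x; rewrite !inE; case: (f x).
split; rewrite ?setUCr ?setICr // => x y; rewrite !inE => xL yL;
  by apply/negP => /adjf; case: (f x) (f y) xL yL => [i|i] [j|j] //; rewrite !inE.
Qed.

(** * Existence of the minimum, and the two implications *)

Lemma ex_least (P : nat -> Prop) :
  (exists k, P k) -> exists k, P k /\ forall k', P k' -> k <= k'.
Proof.
case=> k; elim/ltn_ind: k => k IH Pk.
(* Excluded middle stands in for a decision procedure for [P]. *)
have [[j [jk Pj]]|nex] := classic (exists j, j < k /\ P j); first exact: IH j jk Pj.
exists k; split=> // j Pj; rewrite leqNgt; apply/negP => jk.
by apply: nex; exists j.
Qed.

Lemma tonal_incident_set (G : sgraph) (r : nat) :
  bipartite_tonal r G ->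
  exists U : {set G}, #|incident_edges U| = r /\ in_partition_set U.
Proof.
case=> N tonal; pose m := N.+1; pose n := m + m.
have [|k [[kn col] _]] := tonal n; first by rewrite /n /m; lia.
pose A := [set i : 'I_n | i < m].
have cardA : #|A| = m.
  have -> : A = [set lshift m i | i : 'I_m].
    apply/setP => i; rewrite inE; apply/idP/imsetP => [im|[j _ ->]].
      by exists (Ordinal im) => //; apply: val_inj.
    exact: (ltn_ord j).
  by rewrite card_imset ?card_ord //; apply: lshift_inj.
have cardAC : #|~: A| = m by rewrite cardsCs setCK card_ord cardA /n addnK.
pose R := pair_edges (setX A setT); pose B := pair_edges (setX (~: A) setT).
have colRB : coloring R B.
  split.
    rewrite edges_Knn -imsetU -/(pair_edges _); congr pair_edges.
    by apply/setP => -[i j]; rewrite !inE; case: (i < m).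
  rewrite -imsetI; last by move=> p q _ _; apply: pair_edge_inj.
  apply/setP => E; rewrite in_set0; apply/imsetP => -[[i j]].
  by rewrite !inE; case: (i < m).
(* As n = 2m, both classes have exactly 2m^2 = n^2/2 edges, above every admissible [k]. *)
have cards : k < minn #|R| #|B|.
  rewrite !card_pair_edges !cardsX cardsT card_ord cardA cardAC minnn.
  by rewrite /n in kn *; nia.
case: (col R B colRB cards) => -[W [F [copy cardR cardB]]].
  have [U [UE Upart]] := incident_edges_of_copy A copy.
  by exists U; rewrite UE.
(* In this case the [r] edges are the blue ones, whose left ends lie in the other half. *)
have [U [UE Upart]] := incident_edges_of_copy (~: A) copy.
by exists U; rewrite UE.
Qed.

Lemma balanced_colored_copy (G : sgraph) (U : {set G}) (n : nat)
    (R B : {set {set Knn n}}) :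
  in_partition_set U -> 0 < #|G| -> 16 * #|G| * 2 ^ (256 * #|G|) < n ->
  coloring R B -> n ^ 2 <= 2 * #|R| + 1 -> n ^ 2 <= 2 * #|B| + 1 ->
  has_colored_copy G R B #|incident_edges U| (nedges G - #|incident_edges U|).
Proof.
move=> Upart G0 bign colRB; pose e := fun i j : 'I_n => [set inl i; inr j] \in R.
have [-> ->] := card_coloring colRB; rewrite -/e => balR balB.
have blueE i j : ~~ e i j -> [set inl i; inr j] \in B.
  move=> nij; have : [set inl i; inr j] \in edges (Knn n).
    by rewrite edges_Knn; apply/imsetP; exists (i, j).
  by case: colRB => <- _; rewrite inE => /orP[ij|//]; case/negP: nij.
have inlI : injective (inl : 'I_n -> Knn n) by move=> i j [].
have inrI : injective (inr : 'I_n -> Knn n) by move=> i j [].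
(* The centers may lie on either side of [Knn n]; the second case differs only by swapping [inl] and
   [inr]. *)
have [] := @unavoidable_split_star n #|G| e G0 bign balR balB;
  move=> [T [C1 [C2 [cT cC1 cC2 red blue]]]].
  apply: (@colored_copy_of_split_star _ _ _ _ _ ((inl : _ -> Knn n) @: T)
    ((inr : _ -> Knn n) @: C1) ((inr : _ -> Knn n) @: C2)) => //;
    rewrite ?card_imset // => x y /imsetP[i iT ->] /imsetP[j jC ->].
    exact: red.
  exact/blueE/blue.
apply: (@colored_copy_of_split_star _ _ _ _ _ ((inr : _ -> Knn n) @: T)
  ((inl : _ -> Knn n) @: C1) ((inl : _ -> Knn n) @: C2)) => //;
  rewrite ?card_imset // => x y /imsetP[i iT ->] /imsetP[j jC ->]; rewrite setUC.
  exact: red.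
exact/blueE/blue.
Qed.

Theorem theorem7 (G : sgraph) (r : nat) :
  bipartite G -> 0 < r -> r <= nedges G %/ 2 ->
  (bipartite_tonal r G <->
   exists U : {set G},
     edges_between U (neighbors U) = r /\ in_partition_set U).
Proof.
move=> _ r0 _; split.
  by case/tonal_incident_set=> U [Ur Upart]; exists U; rewrite edges_between_neighbors.
case=> U [+ Upart]; rewrite edges_between_neighbors => Ur.
have G0 : 0 < #|G|.
  have : 0 < #|incident_edges U| by rewrite Ur.
  case/card_gt0P=> E; rewrite inE => /andP[/edgesP[x _] _].
  by apply/card_gt0P; exists x.
(* The offset 2 gives the strict size bound and n >= 2, so n^2/2 rounded down is positive and its
   predecessor is an admissible [k]. Exceeding that [k] means that each color has at least n^2/2
   edges, rounded down. *)
exists (16 * #|G| * 2 ^ (256 * #|G|)).+2 => n bign.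
apply: ex_least; exists (n ^ 2 %/ 2).-1; split; first by nia.
move=> R B colRB bal; left; rewrite -Ur.
by apply: balanced_colored_copy => //; [lia | nia | nia].
Qed.
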